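(* Let $\Sigma\subset\mathbb{R}^{n\times n}$ be the set of state matrices consistent with the data, and let $X_-\in\mathbb{R}^{n\times T}$ be the state data matrix. If there exists a stabilizing logarithmically quantized controller for all systems with $A\in\Sigma$ (for some quantization density $\rho\in(0,1)$), then $\operatorname{rank}(X_-)=n$.
   Context: **Notation.** For symmetric matrices, $>0$, $\ge 0$ and $<0$ denote positive definite, positive semidefinite and negative definite; $I$ denotes the identity matrix. **System and data.** Consider $x(k+1)=A_{s}x(k)+Bu(k)+w(k)$ with state $x(k)\in\mathbb{R}^n$, scalar input $u(k)\in\mathbb{R}$, noise $w(k)\in\mathbb{R}^n$, unknown state matrix $A_{s}\in\mathbb{R}^{n\times n}$ and known $B\in\mathbb{R}^{n}$, with $(A_{s},B)$ stabilizable. A finite trajectory $x(0),u(0),x(1),u(1),\dots,x(T)$ of this system is given. The data matrices are $X_-=[x(0)\ \cdots\ x(T-1)]\in\mathbb{R}^{n\times T}$, $X_+=[x(1)\ \cdots\ x(T)]\in\mathbb{R}^{n\times T}$, $U=[u(0)\ \cdots\ u(T-1)]\in\mathbb{R}^{1\times T}$, and $X_U=X_+-BU$. The noise matrix $W=[w(0)\ \cdots\ w(T-1)]$ is unknown but satisfies $$\begin{bmatrix} I\\ W^{\top}\end{bmatrix}^{\top}\begin{bmatrix}\Phi_{11}&\Phi_{12}\\ \Phi_{12}^{\top}&\Phi_{22}\end{bmatrix}\begin{bmatrix} I\\ W^{\top}\end{bmatrix}\ge 0,$$ where $\Phi_{11}\in\mathbb{R}^{n\times n}$ is a known symmetric matrix,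 $\Phi_{12}\in\mathbb{R}^{n\times T}$ is known, and $\Phi_{22}\in\mathbb{R}^{T\times T}$ is a known symmetric matrix with $\Phi_{22}<0$. The set of state matrices consistent with the data (it contains $A_{s}$) is $$\Sigma=\left\{A\in\mathbb{R}^{n\times n}:\ \begin{bmatrix} I\\ A^{\top}\end{bmatrix}^{\top}\begin{bmatrix} I & X_{U}\\ 0 & -X_{-}\end{bmatrix}\begin{bmatrix}\Phi_{11}&\Phi_{12}\\ \Phi_{12}^{\top}&\Phi_{22}\end{bmatrix}\begin{bmatrix} I & X_{U}\\ 0 & -X_{-}\end{bmatrix}^{\top}\begin{bmatrix} I\\ A^{\top}\end{bmatrix}\ge 0\right\}.$$ **Logarithmic quantizer.** Given $0<\rho<1$ (the quantization density), $\delta=\frac{1-\rho}{1+\rho}$ and $u_0>0$, let $u_i=\rho^{-i}u_0$ for $i\in\mathbb{Z}$. The logarithmic quantizer $f:\mathbb{R}\to\mathbb{R}$ with density $\rho$ is: $f(v)=u_i$ if $v>0$ and $\frac{1}{1+\delta}u_i<v\le\frac{1}{1-\delta}u_i$; $f(0)=0$; $f(v)=-f(-v)$ if $v<0$. A logarithmically quantized controller with density $\rho$ is $u(k)=f(v(k))$, $v(k)=Kx(k)$, with gain $K\in\mathbb{R}^{1\times n}$. **Stabilization.** Stabilization means quadratic stabilization of the noise-free closed loop: the controller with gain $K$ and density $\rho$ stabilizes the system with state matrix $A$ if there are a symmetric $P>0$ and $\varepsilon>0$ with $(Ax+Bf(Kx))^{\top}P(Ax+Bf(Kx))-x^{\top}Px\le-\varepsilon\|x\|^2$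 for all $x\in\mathbb{R}^n$. It is stabilizing for all systems with $A\in\Sigma$ if the same $K$ stabilizes the system for every $A\in\Sigma$ ($P$ and $\varepsilon$ may depend on $A$). *)

(* Defs.v *)
From HB Require Import structures.
From mathcomp Require Import all_boot all_order all_algebra.
From mathcomp Require Import complex classical_sets reals.

Set Implicit Arguments.
Unset Strict Implicit.
Unset Printing Implicit Defensive.

Import Order.TTheory GRing.Theory Num.Theory.

Local Open Scope classical_set_scope.
Local Open Scope ring_scope.

Section Matrices.
Variables (R : realType) (n : nat).

Definition quadf (M : 'M[R]_n) (x : 'cV[R]_n) : R := (x^T *m M *m x) 0 0.

Definition posdefmx (M : 'M[R]_n) : Prop :=
  M^T = M /\ forall x : 'cV[R]_n, x != 0 -> 0 < quadf M x.

Definition possemidefmx (M : 'M[R]_n) : Prop :=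
  M^T = M /\ forall x : 'cV[R]_n, 0 <= quadf M x.

Definition negdefmx (M : 'M[R]_n) : Prop :=
  M^T = M /\ forall x : 'cV[R]_n, x != 0 -> quadf M x < 0.

(* The library norm on matrices is the sup norm; this is the square of the
   Euclidean norm. *)
Definition sqnorm2 (x : 'cV[R]_n) : R := \sum_i x i 0 ^+ 2.

Definition schur_stable (A : 'M[R]_n) : Prop :=
  forall l : R[i], eigenvalue (map_mx (real_complex R) A) l -> `|l| < 1.

Definition stabilizable (A : 'M[R]_n) (B : 'cV[R]_n) : Prop :=
  exists K : 'rV[R]_n, schur_stable (A + B *m K).

End Matrices.

Section Data.
Variables (R : realType) (n T : nat).

Definition is_trajectory (A : 'M[R]_n) (B : 'cV[R]_n)
    (x : nat -> 'cV[R]_n) (u : nat -> R) (w : nat -> 'cV[R]_n) : Prop :=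
  forall k, (k < T)%N -> x k.+1 = A *m x k + u k *: B + w k.

Definition Xminus (x : nat -> 'cV[R]_n) : 'M[R]_(n, T) :=
  \matrix_(i < n, k < T) x k i 0.

Definition Xplus (x : nat -> 'cV[R]_n) : 'M[R]_(n, T) :=
  \matrix_(i < n, k < T) x k.+1 i 0.

Definition Umx (u : nat -> R) : 'rV[R]_T := \row_(k < T) u k.

Definition Wmx (w : nat -> 'cV[R]_n) : 'M[R]_(n, T) :=
  \matrix_(i < n, k < T) w k i 0.

Definition XU (B : 'cV[R]_n) (x : nat -> 'cV[R]_n) (u : nat -> R) :
  'M[R]_(n, T) := Xplus x - B *m Umx u.

Definition Phimx (Phi11 : 'M[R]_n) (Phi12 : 'M[R]_(n, T)) (Phi22 : 'M[R]_T) :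
  'M[R]_(n + T) := block_mx Phi11 Phi12 Phi12^T Phi22.

Definition noise_bound (Phi : 'M[R]_(n + T)) (W : 'M[R]_(n, T)) : Prop :=
  possemidefmx ((col_mx 1%:M W^T)^T *m Phi *m col_mx 1%:M W^T).

Definition data_mx (B : 'cV[R]_n) (x : nat -> 'cV[R]_n) (u : nat -> R) :
  'M[R]_(n + n, n + T) := block_mx 1%:M (XU B x u) 0 (- Xminus x).

Definition Sigma (Phi : 'M[R]_(n + T)) (B : 'cV[R]_n)
    (x : nat -> 'cV[R]_n) (u : nat -> R) : set 'M[R]_n :=
  [set A | possemidefmx
     ((col_mx 1%:M A^T)^T *m data_mx B x u *m Phi *m (data_mx B x u)^T
        *m col_mx 1%:M A^T)].

End Data.

Section Quantizer.
Variable R : realType.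

Definition quant_delta (rho : R) : R := (1 - rho) / (1 + rho).

Definition quant_level (rho u0 : R) (i : int) : R := rho ^ (- i) * u0.

(* For 0 < rho < 1 and 0 < u0 the intervals below, i ranging over int,
   partition the positive half-line: the upper end of the i-th interval is
   the lower end of the (i+1)-st. Hence exactly one f satisfies this. *)
Definition is_log_quantizer (rho u0 : R) (f : R -> R) : Prop :=
  [/\ forall (v : R) (i : int), 0 < v ->
        1 / (1 + quant_delta rho) * quant_level rho u0 i < v ->
        v <= 1 / (1 - quant_delta rho) * quant_level rho u0 i ->
        f v = quant_level rho u0 i,
      f 0 = 0
    & forall v : R, v < 0 -> f v = - f (- v)].

Definition closed_loop n (f : R -> R) (A : 'M[R]_n) (B : 'cV[R]_n)
    (K : 'rV[R]_n) (x : 'cV[R]_n) : 'cV[R]_n :=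
  A *m x + f ((K *m x) 0 0) *: B.

Definition quad_stabilizes n (f : R -> R) (A : 'M[R]_n) (B : 'cV[R]_n)
    (K : 'rV[R]_n) : Prop :=
  exists (P : 'M[R]_n) (eps : R),
    [/\ posdefmx P, 0 < eps
      & forall x : 'cV[R]_n,
          quadf P (closed_loop f A B K x) - quadf P x <= - eps * sqnorm2 x].

End Quantizer.

(* Main.v *)
Require Import Defs.
From HB Require Import structures.
From mathcomp Require Import all_boot all_order all_algebra.
From mathcomp Require Import complex classical_sets reals.

(** Membership of [A] in [Sigma] depends on [A] only through the residual
    [XU - A *m Xminus] ([SigmaE]).  If the rows of [Xminus] are dependent, some
    nonzero row [xi] is killed by [Xminus], and then [Sigma] is invariant under
    every perturbation [A + v *m xi]: the data say nothing about the
    action of the state matrix along [xi^T].  Since [As] lies in [Sigma]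
    ([Sigma_true_system]), the vector [v] is free, and as [xi *m xi^T] is
    nonzero it can be chosen so that [xi^T] is an equilibrium of the closed
    loop of [As + v *m xi] ([equilibrium_perturbation]).  A closed loop with a
    nonzero equilibrium has no strictly decreasing Lyapunov function
    ([quad_stabilizes_no_equilibrium]), so no controller [u = f (K x)]
    stabilizes all of [Sigma]. *)

Set Implicit Arguments.
Unset Strict Implicit.
Unset Printing Implicit Defensive.

Import Order.TTheory GRing.Theory Num.Theory.

Local Open Scope ring_scope.

Lemma sqnorm2E (R : realType) n (x : 'cV[R]_n) : (x^T *m x) 0 0 = sqnorm2 x.
Proof. by rewrite mxE; apply: eq_bigr => i _; rewrite mxE -expr2. Qed.

Lemma sqnorm2_gt0 (R : realType) n (x : 'cV[R]_n) : x != 0 -> 0 < sqnorm2 x.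
Proof.
case/cV0Pn=> i xi_neq0; rewrite /sqnorm2 (bigD1 i) //= ltr_pwDl //.
  by rewrite exprn_even_gt0.
by apply: sumr_ge0 => j _; rewrite sqr_ge0.
Qed.

(** In the noise-bound form, the transpose of the residual of [A] plays the
    role of [W^T]: the residual is the noise that [A] would need to explain the
    data. *)
Lemma SigmaE (R : realType) n T (Phi : 'M[R]_(n + T)) (B : 'cV[R]_n)
    (x : nat -> 'cV[R]_n) (u : nat -> R) (A : 'M[R]_n) :
  Sigma Phi B x u A <-> noise_bound Phi (XU T B x u - A *m Xminus T x).
Proof.
rewrite /Sigma /noise_bound /=.
set C := col_mx 1%:M A^T; set D := data_mx T B x u.
have CD : C^T *m D = (col_mx 1%:M (XU T B x u - A *m Xminus T x)^T)^T.
  rewrite /C /D /data_mx !tr_col_mx !trmx1 !trmxK mul_row_block.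
  by rewrite !mul1mx mulmx0 addr0 mulmxN.
have DC : D^T *m C = col_mx 1%:M (XU T B x u - A *m Xminus T x)^T.
  by apply: trmx_inj; rewrite trmx_mul trmxK CD.
by rewrite CD -(mulmxA _ D^T) DC.
Qed.

Lemma Sigma_true_system (R : realType) n T (Phi : 'M[R]_(n + T))
    (As : 'M[R]_n) (B : 'cV[R]_n)
    (x : nat -> 'cV[R]_n) (u : nat -> R) (w : nat -> 'cV[R]_n) :
  is_trajectory T As B x u w -> noise_bound Phi (Wmx T w) ->
  Sigma Phi B x u As.
Proof.
move=> traj noise; apply/SigmaE; congr noise_bound: noise.
apply/matrixP => i k; rewrite /XU !mxE traj ?ltn_ord // !mxE big_ord1 !mxE.
under [X in _ - X]eq_bigr do rewrite mxE.
by rewrite (mulrC (B i 0)) addrAC addrK addrAC subrr add0r.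
Qed.

Lemma Sigma_perturbation (R : realType) n T (Phi : 'M[R]_(n + T))
    (B : 'cV[R]_n) (x : nat -> 'cV[R]_n) (u : nat -> R)
    (A : 'M[R]_n) (v : 'cV[R]_n) (xi : 'rV[R]_n) :
  xi *m Xminus T x = 0 ->
  Sigma Phi B x u A -> Sigma Phi B x u (A + v *m xi).
Proof.
move=> xiX /SigmaE SA; apply/SigmaE.
by rewrite mulmxDl -mulmxA xiX mulmx0 addr0.
Qed.

(** The closed loop at [x] equals its value for [A] plus [(xi *m x) 0 0 *: v],
    so solving for [v] prescribes the image of [x] at will. *)
Lemma equilibrium_perturbation (R : realType) n (f : R -> R) (A : 'M[R]_n)
    (B : 'cV[R]_n) (K xi : 'rV[R]_n) (x : 'cV[R]_n) :
  (xi *m x) 0 0 != 0 ->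
  exists v : 'cV[R]_n, closed_loop f (A + v *m xi) B K x = x.
Proof.
move=> xix_neq0.
exists (((xi *m x) 0 0)^-1 *: (x - closed_loop f A B K x)).
set y := _ *: _; have yE : y *m xi *m x = (xi *m x) 0 0 *: y.
  by rewrite -mulmxA {1}[xi *m x]mx11_scalar mul_mx_scalar.
by rewrite /closed_loop mulmxDl yE scalerA mulfV // scale1r addrAC addrC subrK.
Qed.

Lemma quad_stabilizes_no_equilibrium (R : realType) n (f : R -> R)
    (A : 'M[R]_n) (B : 'cV[R]_n) (K : 'rV[R]_n) (x : 'cV[R]_n) :
  quad_stabilizes f A B K -> closed_loop f A B K x = x -> x = 0.
Proof.
move=> [P [eps [_ eps_gt0 /(_ x) decr]]] fix_x; apply/eqP/contraT => x_neq0.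
move: decr; rewrite fix_x subrr mulNr oppr_ge0 leNgt.
by rewrite mulr_gt0 // sqnorm2_gt0.
Qed.

Theorem theorem5 (R : realType) (n T : nat)
    (As : 'M[R]_n) (B : 'cV[R]_n)
    (x : nat -> 'cV[R]_n) (u : nat -> R) (w : nat -> 'cV[R]_n)
    (Phi11 : 'M[R]_n) (Phi12 : 'M[R]_(n, T)) (Phi22 : 'M[R]_T)
    (hstab : stabilizable As B)
    (htraj : is_trajectory T As B x u w)
    (hPhi11 : Phi11^T = Phi11)
    (hPhi22 : negdefmx Phi22)
    (hnoise : noise_bound (Phimx Phi11 Phi12 Phi22) (Wmx T w))
    (hctrl : exists (rho u0 : R) (f : R -> R) (K : 'rV[R]_n),
        [/\ 0 < rho < 1, 0 < u0, is_log_quantizer rho u0 f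
          & forall A : 'M[R]_n,
              Sigma (Phimx Phi11 Phi12 Phi22) B x u A ->
              quad_stabilizes f A B K]) :
  \rank (Xminus T x) = n.
Proof.
have [rho [u0 [f [K [_ _ _ stab]]]]] := hctrl.
apply/eqP; change (row_free (Xminus T x)); rewrite -kermx_eq0; apply/contraT.
move=> /rowV0Pn[xi /sub_kermxP xiX xi_neq0].
have xiT_neq0 : xi^T != 0 by rewrite trmx_eq0.
have xixi : (xi *m xi^T) 0 0 != 0.
  by rewrite -[X in X *m _]trmxK sqnorm2E gt_eqF // sqnorm2_gt0.
have [v fix_xi] := equilibrium_perturbation f As B K xixi.
have /stab/quad_stabilizes_no_equilibrium/(_ fix_xi)/eqP :=
  Sigma_perturbation v xiX (Sigma_true_system htraj hnoise).
by rewrite (negPf xiT_neq0).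
Qed.
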